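(* Let $G\neq 1$ be a group given by an extension $$1\longrightarrow K\longrightarrow G\stackrel{\rho}{\longrightarrow} Q\longrightarrow 1$$ where $K$ is a centerless group (i.e. its center is trivial), let $\theta:Q\longrightarrow \mathrm{Out}(K)$ be the associated homomorphism, and let $\pi:G\longrightarrow \mathrm{Aut}(K)$ be the homomorphism defined by $\pi(g)(k)=k^g$ for all $g\in G$, $k\in K$. Then $G$ is icc if and only if both of the following conditions hold: (i) $K$ does not contain a non-trivial normal subgroup $N$, either finite or isomorphic to $\mathbb{Z}^n$ for some $n$, which is preserved by $\pi(G)$ and contains only finite $\pi(G)$-orbits; (ii) the induced homomorphism $\theta:FC(Q)\longrightarrow \mathrm{Out}(K)$ (the restriction of $\theta$ to $FC(Q)$) is injective.
   Context: A group is said to be icc (with infinite conjugacy classes) if it is non-trivial and all its conjugacy classes other than $\{1\}$ are infinite. For a group $H$, $FC(H)$ denotes the union of the finite conjugacy classes of $H$; it is a characteristic subgroup of $H$. $K$ is identified with its image, a normal subgroup of $G$. For $u,g\in G$, $u^g=g^{-1}ug$. Automorphisms are composed as right actions, so that $\pi$ is a homomorphism. $\mathrm{Out}(K)=\mathrm{Aut}(K)/\mathrm{Inn}(K)$, and the associated homomorphism $\theta:Q\to\mathrm{Out}(K)$ sends $q\in Q$ to the class of $\pi(g)$ in $\mathrm{Out}(K)$, for any $g\in G$ with $\rho(g)=q$. The $\pi(G)$-orbit of $k\in K$ is $\{\pi(g)(k): g\in G\}$. *)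

(* Defs.v *)
From HB Require Import structures.
From mathcomp Require Import all_boot all_algebra generic_quotient.
From mathcomp Require Import mathcomp_extra boolp classical_sets functions.
From mathcomp Require Import cardinality.

Set Implicit Arguments.
Unset Strict Implicit.
Unset Printing Implicit Defensive.

Import Algebra.

Local Open Scope classical_set_scope.
Local Open Scope quotient_scope.
Local Open Scope group_scope.

(* A [groupType] may be infinite; the choice operator it carries is available
   on every type in the presence of classical choice. *)
Section Groups.
Variable H : groupType.
Implicit Types N : set H.

Definition conj_class (x : H) : set H := [set x ^ g | g in [set: H]].

Definition nontrivial := exists x : H, x != 1.

Definition icc :=
  nontrivial /\ (forall x : H, x != 1 -> infinite_set (conj_class x)).

Definition FC : set H :=
  \bigcup_(x in [set x | finite_set (conj_class x)]) conj_class x.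

Definition center : set H := [set z | forall x, commute z x].

Definition normal_subgroup N :=
  group_closed (mem N) /\ (forall x g, N x -> N (x ^ g)).

(* [to_multiplicative 'rV[int]_n] is the additive group Z^n, written
   multiplicatively. *)
Definition isomorphic_Zn (n : nat) N :=
  exists f : UMagmaMorphism.type (to_multiplicative 'rV[int]_n) H,
    injective f /\ range f = N.

End Groups.

Arguments FC : clear implicits.
Arguments center : clear implicits.
Arguments nontrivial : clear implicits.
Arguments icc : clear implicits.

Section Automorphisms.
Variable K : groupType.

Definition is_aut (f : K -> K) : Prop :=
  bijective f /\ {morph f : x y / x * y}.

Record Aut := MkAut { aut_fun :> K -> K; aut_subproof : `[< is_aut aut_fun >] }.

HB.instance Definition _ := [isSub for aut_fun].
HB.instance Definition _ := [Choice of Aut by <:].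

Lemma autP (a : Aut) : is_aut a. Proof. exact/asboolP/aut_subproof. Qed.

Lemma autM (a : Aut) : {morph a : x y / x * y}.
Proof. by case: (autP a). Qed.

Lemma aut_inj (a : Aut) : injective a.
Proof. by case: (autP a) => /bij_inj. Qed.

Lemma aut_eq (a b : Aut) : a =1 b -> a = b.
Proof. by move=> eq_ab; apply/val_inj/funext. Qed.

Lemma aut1 (a : Aut) : a 1 = 1.
Proof. by apply: (@mulgI _ (a 1)); rewrite -autM !mulg1. Qed.

Lemma autV (a : Aut) : {morph a : x / x^-1}.
Proof. by move=> x; apply: (@mulgI _ (a x)); rewrite -autM !mulgV aut1. Qed.

Definition mk_aut (f : K -> K) (fP : is_aut f) : Aut := MkAut (asboolT fP).

Fact aut_one_subproof : is_aut id.
Proof. by split=> //; exists id. Qed.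

Definition aut_one := mk_aut aut_one_subproof.

Fact aut_mul_subproof (a b : Aut) : is_aut (b \o a).
Proof.
case: (autP a) (autP b) => [ba aM] [bb bM]; split; first exact: bij_comp.
by move=> x y /=; rewrite aM bM.
Qed.

(* Automorphisms act on the right: [a * b] is [a] followed by [b]. *)
Definition aut_mul (a b : Aut) : Aut := mk_aut (aut_mul_subproof a b).

Fact aut_inv_subproof (a : Aut) :
  {b : Aut | cancel a b /\ cancel b a}.
Proof.
apply: cid; have [[b aK bK] aM] := autP a.
have bP : is_aut b.
  by split; [exists a | move=> x y; apply: (canLR aK); rewrite aM !bK].
by exists (mk_aut bP).
Qed.

Definition aut_inv (a : Aut) : Aut := sval (aut_inv_subproof a).

Lemma aut_invK (a : Aut) : cancel a (aut_inv a).
Proof. by rewrite /aut_inv; case: aut_inv_subproof => ? []. Qed.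

Lemma aut_invKV (a : Aut) : cancel (aut_inv a) a.
Proof. by rewrite /aut_inv; case: aut_inv_subproof => ? []. Qed.

Fact aut_mulA : associative aut_mul.
Proof. by move=> a b c; apply: aut_eq. Qed.
Fact aut_mul1g : left_id aut_one aut_mul.
Proof. by move=> a; apply: aut_eq. Qed.
Fact aut_mulg1 : right_id aut_one aut_mul.
Proof. by move=> a; apply: aut_eq. Qed.
Fact aut_mulVg : left_inverse aut_one aut_inv aut_mul.
Proof. by move=> a; apply: aut_eq => x /=; rewrite aut_invKV. Qed.
Fact aut_mulgV : right_inverse aut_one aut_inv aut_mul.
Proof. by move=> a; apply: aut_eq => x /=; rewrite aut_invK. Qed.

HB.instance Definition _ :=
  isGroup.Build Aut aut_mulA aut_mul1g aut_mulg1 aut_mulVg aut_mulgV.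

Lemma aut_mulE (a b : Aut) x : (a * b) x = b (a x).
Proof. by []. Qed.

Lemma aut_oneE x : (1 : Aut) x = x.
Proof. by []. Qed.

Lemma aut_VK (a : Aut) : cancel a (a^-1)%g.
Proof. exact: aut_invK. Qed.

Lemma aut_VKV (a : Aut) : cancel (a^-1)%g a.
Proof. exact: aut_invKV. Qed.

Fact inner_subproof (k : K) : is_aut (fun x => x ^ k).
Proof.
by split=> [|x y]; [exists (fun x => x ^ k^-1); [exact: conjgK|exact: conjgKV]
                   | exact: conjMg].
Qed.

Definition inner (k : K) : Aut := mk_aut (inner_subproof k).

Definition Inn : set Aut := range inner.

Lemma innerE k x : inner k x = x ^ k. Proof. by []. Qed.

Lemma innerM : {morph inner : x y / x * y}.
Proof. by move=> x y; apply: aut_eq => z; rewrite aut_mulE !innerE conjgM. Qed.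

Lemma inner1 : inner 1 = 1.
Proof. by apply: aut_eq => z; rewrite innerE conjg1. Qed.

Lemma innerV : {morph inner : x / x^-1}.
Proof.
by move=> x; apply: (@mulgI _ (inner x)); rewrite -innerM !mulgV inner1.
Qed.

Lemma innerJ (a : Aut) k : inner k ^ a = inner (a k).
Proof.
apply: aut_eq => x; rewrite conjgE !aut_mulE !innerE !conjgE.
by rewrite !autM autV aut_VKV.
Qed.

Lemma Inn1 : Inn 1.
Proof. by exists 1 => //; exact: inner1. Qed.

Lemma InnM a b : Inn a -> Inn b -> Inn (a * b).
Proof. by move=> [x _ <-] [y _ <-]; exists (x * y) => //; exact: innerM. Qed.

Lemma InnV a : Inn a -> Inn a^-1.
Proof. by move=> [x _ <-]; exists x^-1 => //; exact: innerV. Qed.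

Lemma InnJ a b : Inn a -> Inn (a ^ b).
Proof. by move=> [x _ <-]; exists (b x) => //; rewrite innerJ. Qed.

Definition out_rel : rel Aut := fun a b => `[< Inn (a^-1 * b) >].

Fact out_rel_refl : reflexive out_rel.
Proof. by move=> a; apply/asboolP; rewrite mulVg; exact: Inn1. Qed.

Fact out_rel_sym : symmetric out_rel.
Proof.
suff sub a b : out_rel a b -> out_rel b a by move=> a b; apply/idP/idP => /sub.
by move=> /asboolP/InnV; rewrite invgM invgK => ?; apply/asboolP.
Qed.

Fact out_rel_trans : transitive out_rel.
Proof.
move=> b a c /asboolP ab /asboolP bc; apply/asboolP.
by have := InnM ab bc; rewrite mulgA mulgK.
Qed.

Canonical out_equiv := EquivRel out_rel out_rel_refl out_rel_sym out_rel_trans.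

Definition Out := {eq_quot out_equiv}.

HB.instance Definition _ := Choice.on Out.
HB.instance Definition _ := EqQuotient.on Out.

Lemma outP (a b : Aut) : \pi_Out a = \pi_Out b <-> Inn (a^-1 * b).
Proof.
by split=> [/eqquotP/asboolP//|ab]; apply/eqquotP/asboolP.
Qed.

Definition out_one : Out := \pi_Out 1.
Definition out_mul (u v : Out) : Out := \pi_Out (repr u * repr v).
Definition out_inv (u : Out) : Out := \pi_Out (repr u)^-1.

Lemma Inn_repr (a : Aut) : Inn (a^-1 * repr (\pi_Out a)).
Proof. by apply/outP; rewrite reprK. Qed.

Lemma pi_outM (a b : Aut) : out_mul (\pi_Out a) (\pi_Out b) = \pi_Out (a * b).
Proof.
apply/esym/outP; set a' := repr _; set b' := repr _.
have -> : (a * b)^-1 * (a' * b') = (a^-1 * a') ^ b * (b^-1 * b').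
  by rewrite conjgE invgM !mulgA mulgK.
by apply: InnM; [apply: InnJ|]; exact: Inn_repr.
Qed.

Lemma pi_outV (a : Aut) : out_inv (\pi_Out a) = \pi_Out a^-1.
Proof.
apply/outP; rewrite invgK -(invgK (_ * _)) invgM invgK.
apply: InnV.
have -> : a * (repr (\pi_Out a))^-1 = ((a^-1 * repr (\pi_Out a)) ^ a^-1)^-1.
  by rewrite conjgE invgK !mulgA mulgV mul1g invgM invgK.
exact/InnV/InnJ/Inn_repr.
Qed.

Fact out_mulA : associative out_mul.
Proof.
elim/quotW=> a; elim/quotW=> b; elim/quotW=> c.
by rewrite (pi_outM b c) (pi_outM a b) (pi_outM a) (pi_outM _ c) mulgA.
Qed.
Fact out_mul1g : left_id out_one out_mul.
Proof. by elim/quotW=> a; rewrite (pi_outM 1 a) mul1g. Qed.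
Fact out_mulg1 : right_id out_one out_mul.
Proof. by elim/quotW=> a; rewrite (pi_outM a 1) mulg1. Qed.
Fact out_mulVg : left_inverse out_one out_inv out_mul.
Proof. by elim/quotW=> a; rewrite pi_outV (pi_outM _ a) mulVg. Qed.
Fact out_mulgV : right_inverse out_one out_inv out_mul.
Proof. by elim/quotW=> a; rewrite pi_outV (pi_outM a) mulgV. Qed.

HB.instance Definition _ :=
  isGroup.Build Out out_mulA out_mul1g out_mulg1 out_mulVg out_mulgV.

Lemma out_classM (a b : Aut) : \pi_Out (a * b) = \pi_Out a * \pi_Out b.
Proof. by rewrite -pi_outM. Qed.

End Automorphisms.

(* 1 -> K -> G -> Q -> 1, with [K] not necessarily a subset of [G]: it is
   identified with the range of [ext_inj]. *)
Record extension (K G Q : groupType) := Extension {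
  ext_inj : UMagmaMorphism.type K G;
  ext_proj : UMagmaMorphism.type G Q;
  ext_inj_injective : injective ext_inj;
  ext_proj_surjective : forall q, exists g, ext_proj g = q;
  ext_exact : range ext_inj = ext_proj @^-1` [set 1]
}.

Section Extension.
Variables (K G Q : groupType) (E : extension K G Q).
Local Notation iota := (ext_inj E).
Local Notation rho := (ext_proj E).

Fact ext_conj_subproof (g : G) (k : K) : {k' : K | iota k' = iota k ^ g}.
Proof.
apply: cid; suff [k' _ <-] : range iota (iota k ^ g) by exists k'.
rewrite (ext_exact E) /preimage /= gmulfJ.
suff -> : rho (iota k) = 1 by rewrite conj1g.
have : range iota (iota k) by exists k.
by rewrite (ext_exact E).
Qed.

(* The element of [K] that [ext_inj] maps to the conjugate of [k] by [g]. *)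
Definition ext_conj (g : G) (k : K) : K := sval (ext_conj_subproof g k).

Lemma ext_conjE g k : iota (ext_conj g k) = iota k ^ g.
Proof. by rewrite /ext_conj; case: ext_conj_subproof. Qed.

Fact ext_pi_subproof g : is_aut (ext_conj g).
Proof.
split=> [|x y]; last first.
  by apply: (@ext_inj_injective _ _ _ E); rewrite gmulfM !ext_conjE gmulfM conjMg.
by exists (ext_conj g^-1) => x; apply: (@ext_inj_injective _ _ _ E);
  rewrite !ext_conjE ?conjgK ?conjgKV.
Qed.

Definition ext_pi (g : G) : Aut K := mk_aut (ext_pi_subproof g).

Lemma ext_piE g k : iota (ext_pi g k) = iota k ^ g.
Proof. exact: ext_conjE. Qed.

Fact ext_pi_morph : monoid_morphism ext_pi.
Proof.
split=> [|g h]; apply: aut_eq => k; apply: (@ext_inj_injective _ _ _ E).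
  by rewrite ext_piE conjg1.
by rewrite ext_piE aut_mulE !ext_piE conjgM.
Qed.

HB.instance Definition _ := isUMagmaMorphism.Build G (Aut K) ext_pi ext_pi_morph.

Definition ext_lift (q : Q) : G := sval (cid (ext_proj_surjective E q)).

Lemma ext_liftK q : rho (ext_lift q) = q.
Proof. by rewrite /ext_lift; case: cid. Qed.

(* By [ext_thetaE] below, the value does not depend on the lift of [q]. *)
Definition ext_theta (q : Q) : Out K := \pi_(Out K) (ext_pi (ext_lift q)).

Lemma ext_thetaE g : ext_theta (rho g) = \pi_(Out K) (ext_pi g).
Proof.
apply/outP; set h := ext_lift _.
have [k _ kE] : range iota (h^-1 * g).
  by rewrite (ext_exact E) /preimage /= gmulfM gmulfV ext_liftK mulVg.
exists k => //; apply: aut_eq => x; apply: (@ext_inj_injective _ _ _ E).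
by rewrite -gmulfV -gmulfM ext_piE innerE gmulfJ kE.
Qed.

Fact ext_theta_morph : monoid_morphism ext_theta.
Proof.
split=> [|p q]; first by rewrite -(gmulf1 (s := rho)) ext_thetaE gmulf1.
rewrite -[p in LHS]ext_liftK -[q in LHS]ext_liftK -gmulfM ext_thetaE gmulfM.
by rewrite out_classM.
Qed.

HB.instance Definition _ :=
  isUMagmaMorphism.Build Q (Out K) ext_theta ext_theta_morph.

Definition ext_orbit (k : K) : set K := [set ext_pi g k | g in [set: G]].

End Extension.

(* Main.v *)
Require Import Defs.
From mathcomp Require Import all_boot all_algebra.
From mathcomp Require Import boolp classical_sets functions cardinality.
From HB Require Import structures.

Set Implicit Arguments.
Unset Strict Implicit.
Unset Printing Implicit Defensive.

Import Algebra GRing.Theory.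

Local Open Scope classical_set_scope.
Local Open Scope group_scope.

(* For [k] in [K], the [G]-orbit of [k] is its conjugacy class in [G], so a
   subgroup [N] as in (i) consists of elements of [FC G]. Conversely let [k] be
   a non-trivial element of [K] in [FC G], with conjugacy class [C]. If [k] has
   finite order then [C] generates a finite group (Dietzmann's lemma). If
   [FC G] meets [K] in a torsion-free group, then [m = |C|!] is such that
   [c ^+ m] commutes with all of [C], for [c] in [C]; hence the conjugates of
   [k ^+ m] generate a finitely generated torsion-free abelian group. *)

(** * Subgroups as sets, generated subgroups, torsion *)

Section Subgroups.
Variable H : groupType.
Implicit Types (C N S : set H) (x y c : H).

Definition subgroup S := group_closed (mem S).

Lemma subgroupP S :
  subgroup S <-> S 1 /\ (forall x y, S x -> S y -> S (x / y)).
Proof.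
split=> [[S1 SF]|[S1 SF]]; split.
- by move: S1; rewrite inE.
- by move=> x y Sx Sy; move: (SF x y); rewrite !inE; apply.
- by rewrite inE.
- by move=> x y; rewrite !inE; apply: SF.
Qed.

Lemma subgroup1 S : subgroup S -> S 1.
Proof. by case/subgroupP. Qed.

Lemma subgroupF S x y : subgroup S -> S x -> S y -> S (x / y).
Proof. by case/subgroupP=> _; apply. Qed.

Lemma subgroupV S x : subgroup S -> S x -> S x^-1.
Proof. by move=> gS; rewrite -div1g; apply: subgroupF (subgroup1 gS). Qed.

Lemma subgroupM S x y : subgroup S -> S x -> S y -> S (x * y).
Proof.
by move=> gS Sx Sy; rewrite -[y]invgK; exact: subgroupF gS Sx (subgroupV gS Sy).
Qed.

Lemma subgroupX S x n : subgroup S -> S x -> S (x ^+ n).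
Proof.
move=> gS Sx; elim: n => [|n IH]; first by rewrite expg0; exact: subgroup1.
by rewrite expgS; exact: subgroupM.
Qed.

Lemma centralizer_subgroup x : subgroup [set y | commute x y].
Proof.
apply/subgroupP; split=> [|y z /= cy cz]; first exact: commute1.
by apply: commuteM => //; exact: commuteV.
Qed.

Lemma smallest_subgroup C : subgroup (smallest subgroup C).
Proof.
apply/subgroupP; split=> [S [gS _]|x y xS yS S SP]; first exact: subgroup1.
by have [gS _] := SP; apply: subgroupF gS _ _; [exact: xS | exact: yS].
Qed.

(** The preimage under [f] of the generated subgroup is a subgroup containing [C]. This makes the
    subgroup generated by an orbit stable under [ext_pi]. *)
Lemma smallest_subgroup_morph C (f : H -> H) : f 1 = 1 ->
  {morph f : x y / x / y} -> (forall x, C x -> C (f x)) ->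
  forall x, smallest subgroup C x -> smallest subgroup C (f x).
Proof.
move=> f1 fF Cf x Cx.
suff: smallest subgroup C `<=` f @^-1` smallest subgroup C by apply.
apply: smallest_sub => [|y Cy]; last by apply: sub_gen_smallest; exact: Cf.
apply/subgroupP; split=> [|y z]; rewrite /preimage /=.
  by rewrite f1; exact: subgroup1 (smallest_subgroup _).
by rewrite fF; exact: subgroupF (smallest_subgroup C).
Qed.

Definition torsion x := exists2 m, (0 < m)%N & x ^+ m = 1.

End Subgroups.

Arguments subgroup {H} S.

(** * Words over a finite alphabet *)

Lemma size_count_le (T : eqType) (r w : seq T) (n : nat) :
  {subset w <= r} -> (forall c, c \in r -> count_mem c w <= n)%N ->
  (size w <= size r * n)%N.
Proof.
move=> /allP; rewrite all_count => /eqP <-.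
elim: r => [|c r IH] le_n; first by rewrite (eq_count (a2 := pred0)) ?count_pred0.
rewrite (eq_count (a2 := predU (pred1 c) (mem r))); last first.
  by move=> x; rewrite /= in_cons.
apply: leq_trans (_ : count_mem c w + count (mem r) w <= _)%N.
  by rewrite -count_predUI leq_addr.
rewrite mulSn leq_add ?le_n ?mem_head// IH// => d dr.
by rewrite le_n// in_cons dr orbT.
Qed.

Lemma finite_words (T : choiceType) (r : seq T) n :
  finite_set [set w : seq T | {subset w <= r} /\ (size w <= n)%N].
Proof.
elim: n => [|n IH].
  apply: sub_finite_set (finite_set1 [::]) => w [_].
  by rewrite leqn0 size_eq0 => /eqP.
apply: sub_finite_set (_ : finite_set
  ([set [::]] `|` [set x :: w | x in [set` r] & w in
    [set w : seq T | {subset w <= r} /\ (size w <= n)%N]])); last first.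
  by rewrite finite_setU; split=> //; exact: finite_image2.
move=> [|x w] [wr]; first by left.
rewrite /= ltnS => wn; right; exists x; first by apply: wr; rewrite mem_head.
by exists w => //; split=> // y yw; apply: wr; rewrite in_cons yw orbT.
Qed.

(** * Dietzmann's lemma *)

Section Dietzmann.
Variable H : groupType.
Variables (s : seq H) (m : nat).
Hypothesis sJ : forall x y : H, x \in s -> y \in s -> x ^ y \in s.
Hypothesis m_gt0 : (0 < m)%N.
Hypothesis sX : forall x : H, x \in s -> x ^+ m = 1.

(** Occurrences of [c] can be collected at the front: a letter that they jump over is replaced by a
    conjugate, which is again a letter. *)
Lemma word_pull (c : H) n (w : seq H) :
  c \in s -> {subset w <= s} -> (n <= count_mem c w)%N ->
  exists2 w' : seq H, {subset w' <= s} &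
    (size w' + n)%N = size w /\ \prod_(x <- w) x = c ^+ n * \prod_(x <- w') x.
Proof.
move=> cs; have sJX x k : x \in s -> x ^ (c ^+ k) \in s.
  elim: k x => [|k IH] x xs; first by rewrite conjg1.
  by rewrite expgS conjgM IH// sJ.
elim: w n => [|x w IH] [|n] ws nle //.
- by exists [::]; rewrite ?mul1g.
- by exists (x :: w); rewrite ?addn0 ?mul1g.
have /IH{}IH : {subset w <= s} by move=> y yw; rewrite ws// in_cons yw orbT.
move: nle => /=; have [->|xc] := eqVneq x c.
  rewrite add1n ltnS => /IH[w' w's [sw' pw']]; exists w' => //.
  by rewrite addnS sw' big_cons pw' mulgA -expgS.
(* The power of [c] passes to the left of [x] by [x * y = y * x ^ y]. *)
rewrite add0n => /IH[w' w's [sw' pw']]; exists (x ^ (c ^+ n.+1) :: w').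
  move=> y; rewrite in_cons => /orP[/eqP->|/w's//].
  by rewrite sJX// ws// mem_head.
by rewrite /= addSn sw' !big_cons pw' mulgA (conjgC x) -mulgA.
Qed.

(** A word of more than [size s * m] letters repeats some letter at least [m] times. Pulled to the
    front, [m] copies of it multiply to 1 and can be erased; as [m] is positive, the word gets
    shorter. *)
Lemma word_short (w : seq H) : {subset w <= s} ->
  exists2 w' : seq H, {subset w' <= s} /\ (size w' <= size s * m)%N &
    \prod_(x <- w) x = \prod_(x <- w') x.
Proof.
have [n] := ubnP (size w); elim: n w => // n IH w + ws.
have [ww _|wgt] := leqP (size w) (size s * m); first by exists w.
rewrite ltnS => wn.
have [c cs mc] : exists2 c, c \in s & (m <= count_mem c w)%N.
  apply: contrapT => nex; move: wgt; rewrite ltnNge size_count_le// => c cs.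
  by rewrite leqNgt; apply/negP => /ltnW mc; apply: nex; exists c.
have [w' w's [sw' ->]] := word_pull cs ws mc; rewrite sX// mul1g.
by apply: IH w's; apply: leq_trans wn; rewrite -sw' -addn1 leq_add2l.
Qed.

Lemma finite_smallest_subgroup : finite_set (smallest subgroup [set` s]).
Proof.
pose W := [set \prod_(x <- w) x | w in [set w : seq H | {subset w <= s}]].
have WM x y : W x -> W y -> W (x * y).
  move=> [u us <-] [v vs <-]; exists (u ++ v); last by rewrite big_cat.
  by move=> z; rewrite mem_cat => /orP[/us|/vs].
have W1 : W 1 by exists [::]; rewrite ?big_nil.
have WX x n : W x -> W (x ^+ n).
  by move=> Wx; elim: n => // n IH; rewrite expgS; exact: WM.
have sW x : x \in s -> W x.
  move=> xs; exists [:: x]; last by rewrite big_seq1.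
  by move=> y; rewrite inE => /eqP->.
have WV x : W x -> W x^-1.
  move=> [w ws <-] {x}.
  elim: w ws => [|x w IH] ws; first by rewrite big_nil invg1.
  rewrite big_cons invgM; apply: WM.
    by apply: IH => y yw; apply: ws; rewrite in_cons yw orbT.
  have xs : x \in s by rewrite ws ?mem_head.
  (* Words use no inverse letters: the exponent [m] turns inverses into positive powers. *)
  rewrite (_ : x^-1 = x ^+ m.-1); first exact/WX/sW.
  by apply: mulg1_eq; rewrite -expgS prednK// sX.
apply: sub_finite_set (_ : finite_set W).
  apply: smallest_sub => //; apply/subgroupP; split=> // x y Wx Wy.
  by apply: WM => //; exact: WV.
apply: sub_finite_set (finite_image (fun w : seq H => \prod_(x <- w) x)
  (finite_words s (size s * m))).
by move=> _ [w /word_short[w' w'P ->] <-]; exists w'.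
Qed.

End Dietzmann.

(** * Integer powers and homomorphic images of Z^n *)

Section IntegerPowers.
Variable H : groupType.
Implicit Types (x y c : H) (a b : int).

Definition expz c a : H :=
  match a with Posz n => c ^+ n | Negz n => c ^- n.+1 end.

Lemma expzS c a : expz c (a + 1)%R = expz c a * c.
Proof.
case: a => n; first by rewrite -PoszD addn1 /= expgSr.
(* [Negz n] is [- n.+1], so adding 1 leaves the negative range exactly when [n] is 0. *)
rewrite NegzE; case: n => [|n].
  by rewrite addNr /= expg1 mulVg.
rewrite -addn1 PoszD opprD addrNK -NegzE /=.
by rewrite addn0 [X in _ = X^-1 * _]expgS invgM mulgVK.
Qed.

Lemma expzD c a b : expz c (a + b)%R = expz c a * expz c b.
Proof.
have expzB a' : expz c (a' - 1)%R = expz c a' / c.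
  by rewrite -{2}[a'](subrK 1%R) expzS mulgK.
elim/int_ind: b => [|n IH|n IH]; first by rewrite addr0 mulg1.
  by rewrite -addn1 PoszD addrA !expzS IH mulgA.
by rewrite -addn1 PoszD opprD addrA !expzB IH mulgA.
Qed.

Lemma commute_expz x c a : commute x c -> commute x (expz c a).
Proof.
by case: a => n xc /=; [exact: commuteX | apply: commuteV; exact: commuteX].
Qed.

Lemma subgroup_expz (S : set H) c a : subgroup S -> S c -> S (expz c a).
Proof.
by case: a => n gS Sc /=; [|apply: subgroupV => //]; exact: subgroupX.
Qed.

Definition zmorph n (f : 'rV[int]_n -> H) :=
  {morph f : u v / (u + v)%R >-> u * v}.

Lemma zmorph0 n (f : 'rV[int]_n -> H) : zmorph f -> f 0%R = 1.
Proof. by move=> fD; apply: (@mulgI _ (f 0%R)); rewrite -fD addr0 mulg1. Qed.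

Lemma zmorphN n (f : 'rV[int]_n -> H) u : zmorph f -> f (- u)%R = (f u)^-1.
Proof.
by move=> fD; apply: (@mulgI _ (f u)); rewrite -fD subrr mulgV zmorph0.
Qed.

Lemma zmorphMn n (f : 'rV[int]_n -> H) u k :
  zmorph f -> f (u *+ k)%R = f u ^+ k.
Proof.
move=> fD; elim: k => [|k IH]; first by rewrite mulr0n zmorph0.
by rewrite mulrS fD IH expgS.
Qed.

Lemma zmorphZ n (f : 'rV[int]_n -> H) u a :
  zmorph f -> f (a *: u)%R = expz (f u) a.
Proof.
move=> fD; case: a => k /=; first by rewrite -natz scaler_nat zmorphMn.
by rewrite NegzE scaleNr zmorphN// -natz scaler_nat zmorphMn.
Qed.

Lemma zmorph_inj n (f : 'rV[int]_n -> H) :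
  zmorph f -> (forall u, f u = 1 -> u = 0%R) -> injective f.
Proof.
move=> fD f0 u v fuv; apply/eqP; rewrite -subr_eq0; apply/eqP/f0.
by rewrite fD fuv -fD subrr zmorph0.
Qed.

Lemma zmorph_range_subgroup n (f : 'rV[int]_n -> H) :
  zmorph f -> subgroup (range f).
Proof.
move=> fD; apply/subgroupP; split; first by exists 0%R => //; exact: zmorph0.
by move=> _ _ [u _ <-] [v _ <-]; exists (u - v)%R => //; rewrite fD zmorphN.
Qed.

(** One coordinate per generator: each new generator [c] contributes the factor [expz c a], with [a]
    the new first coordinate. *)
Lemma commuting_zmorph (s : seq H) :
  (forall x y, x \in s -> y \in s -> commute x y) ->
  exists n, exists2 f : 'rV[int]_n -> H,
    zmorph f & range f = smallest subgroup [set` s].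
Proof.
elim: s => [|c s IH] cs.
  exists 0%N, (fun=> 1) => [u v|]; first by rewrite mulg1.
  apply/seteqP; split=> [_ [_ _ <-]|].
    exact: subgroup1 (smallest_subgroup _).
  apply: smallest_sub => //; apply: (@zmorph_range_subgroup 0) => u v.
  by rewrite mulg1.
have [x y xs ys|n [f fD fE]] := IH.
  by apply: cs; rewrite inE ?xs ?ys orbT.
(* The centralizer of [c] is a subgroup containing [s], hence it contains [range f]; this makes [g]
   below additive. *)
have cf u : commute c (f u).
  have: range f `<=` [set y | commute c y].
    rewrite fE; apply: smallest_sub; first exact: centralizer_subgroup.
    by move=> y /= ys; apply: cs; rewrite inE ?eqxx// ys orbT.
  by apply; exists u.
pose g (u : 'rV[int]_(1 + n)) := expz c (lsubmx u 0%R 0%R) * f (rsubmx u).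
have gD : zmorph g.
  move=> u v; rewrite /g !linearD !mxE expzD fD !mulgA; congr (_ * _).
  rewrite -!mulgA; congr (_ * _); apply/esym/commute_expz/commute_sym/cf.
exists (1 + n)%N, g => //; apply/seteqP; split.
  move=> _ [u _ <-]; apply: subgroupM (smallest_subgroup _) _ _.
    apply: subgroup_expz (smallest_subgroup _) _.
    by apply: sub_gen_smallest; rewrite /= mem_head.
  have: smallest subgroup [set` s] (f (rsubmx u)).
    by rewrite -fE; exists (rsubmx u).
  apply: (sub_smallest2r (smallest_subgroup _)) => y /= ys.
  by rewrite inE ys orbT.
apply: smallest_sub; first exact: zmorph_range_subgroup.
move=> x /=; rewrite inE => /orP[/eqP->|xs].
  exists (row_mx (const_mx 1%R) 0%R) => //.
  by rewrite /g row_mxKl row_mxKr mxE zmorph0// mulg1 /= expg1.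
have [u _ fu] : range f x by rewrite fE; apply: sub_gen_smallest.
exists (row_mx 0%R u) => //.
by rewrite /g row_mxKl row_mxKr mxE fu /= mul1g.
Qed.

(* A relation [v] is a multiple of a unimodular row (Smith normal form); as
   the range is torsion-free, that row is itself killed by [f], and completing
   it to a basis presents the same range with one generator less. *)
Lemma zmorph_reduce n (f : 'rV[int]_(1 + n) -> H) : zmorph f ->
  (forall x, range f x -> torsion x -> x = 1) ->
  (exists2 v, f v = 1 & v <> 0%R) ->
  exists2 g : 'rV[int]_n -> H, zmorph g & range g = range f.
Proof.
move=> fD tf [v fv v0].
have [L Lu [R Ru [d _ vE]]] := int_Smith_normal_form v.
pose h u := f (u *m R)%R.
have hD : zmorph h by move=> u w; rewrite /h mulmxDl fD.
have he : h (row_mx 1%:M 0)%R = 1.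
  apply: tf; first by eexists.
  (* [L] is an invertible 1 by 1 integer matrix, so [z] is the first invariant factor up to sign,
     and [v] is [z] times the first row of [R]. *)
  pose z := (L 0 0 * d`_0)%R.
  have vz : v = (z *: (row_mx 1%:M 0 *m R))%R.
    rewrite {1}vE (_ : \matrix_(i, j) _ = d`_0 *: row_mx 1%:M 0)%R.
      by rewrite [L]mx11_scalar mul_scalar_mx scalerA -scalemxAl.
    apply/matrixP=> i j; rewrite !mxE ord1.
    case: splitP => k jk; rewrite !mxE ?ord1 jk /=.
      by rewrite !ord1 mulr1.
    by rewrite mulr0.
  exists `|z|%N.
    by rewrite absz_gt0; apply/eqP => z0; apply: v0; rewrite vz z0 scale0r.
  move: fv; rewrite {1}vz zmorphZ// -/(h _); case: (z) => // k /= /eqP.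
  by rewrite invg_eq1 => /eqP.
have he0 (a : 'M[int]_1) : h (row_mx a 0)%R = 1.
  have -> : row_mx a 0%R = (a 0 0 *: row_mx 1%:M 0 :> 'rV[int]_(1 + n))%R.
    by rewrite scale_row_mx scaler0 scalemx1 -mx11_scalar.
  by rewrite zmorphZ// he; case: (a 0%R 0%R) => k /=; rewrite expg1n ?invg1.
exists (fun u => h (row_mx 0 u)%R).
  by move=> u w; rewrite -hD add_row_mx addr0.
apply/seteqP; split=> [_ [u _ <-]|_ [u _ <-]]; first by eexists.
pose w := (u *m invmx R)%R; exists (rsubmx w) => //.
have -> : f u = h w by rewrite /h /w mulmxKV.
by rewrite -[in RHS](hsubmxK w) -[lsubmx w]addr0 -[rsubmx w in RHS]add0r
  -add_row_mx hD he0 mul1g.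
Qed.

Lemma isomorphic_Zn_range n (f : 'rV[int]_n -> H) :
  zmorph f -> injective f -> isomorphic_Zn n (range f).
Proof.
move=> fD f_inj.
pose mf := isUMagmaMorphism.Build (to_multiplicative 'rV[int]_n) H f
  (zmorph0 fD, fD).
pose F : UMagmaMorphism.type (to_multiplicative 'rV[int]_n) H := HB.pack f mf.
by exists F.
Qed.

(** Induction on the number of generators: either [f] has trivial kernel, or a relation allows one
    generator to be dropped without changing the range. *)
Lemma torsion_free_isomorphic_Zn n (f : 'rV[int]_n -> H) : zmorph f ->
  (forall x, range f x -> torsion x -> x = 1) ->
  exists m, isomorphic_Zn m (range f).
Proof.
elim: n f => [|n IH] f fD tf.
  exists 0%N; apply: isomorphic_Zn_range => // u v _.
  by rewrite [u]thinmx0 [v]thinmx0.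
have [rel|free] := pselect (exists2 v, f v = 1 & v <> 0%R).
  have [g gD gE] := @zmorph_reduce n f fD tf rel.
  by rewrite -gE; apply: IH; rewrite // gE.
exists n.+1; apply/isomorphic_Zn_range/zmorph_inj => // u fu.
by apply: contrapT => u0; apply: free; exists u.
Qed.

End IntegerPowers.

(** * Finite conjugacy classes and the subgroup FC *)

Lemma common_commuting_power (H : groupType) (C : set H) : finite_set C ->
  (forall x y, C x -> C y -> C (x ^ y)) ->
  exists2 m, (0 < m)%N & forall x y, C x -> C y -> commute (x ^+ m) y.
Proof.
move=> /finite_seqP[s ->] /= sJ; exists (size s)`!; first exact: fact_gt0.
move=> c d cs ds.
have dX n : d ^ (c ^+ n) \in s.
  by elim: n => [|n IH]; rewrite ?conjg1// expgSr conjgM sJ.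
(* Pigeonhole: the conjugates of [d] by [c ^+ i], for [i] from 0 to [size s], lie in [s], so two of
   them agree. The difference of the two exponents is [n], which divides the factorial of
   [size s]. *)
have [n /andP[n0 ns] cn] :
    exists2 n, (0 < n <= size s)%N & commute (c ^+ n) d.
  apply: contrapT => noex.
  suff: (size [seq (d ^ (c ^+ i))%g | i <- iota 0 (size s).+1] <= size s)%N.
    by rewrite size_map size_iota ltnn.
  apply: uniq_leq_size => [|_ /mapP[i _ ->]//].
  rewrite map_inj_in_uniq ?iota_uniq// => i j; rewrite !mem_iota !add0n !ltnS /=.
  wlog ij : i j / (i <= j)%N => [wl|] il jl e.
    by have /orP[?|?] := leq_total i j; [apply: wl|apply/esym/wl].
  move: ij; rewrite leq_eqVlt => /orP[/eqP//|ij]; case: noex.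
  exists (j - i)%N; first by rewrite subn_gt0 ij (leq_trans _ jl)// leq_subr.
  move: e; rewrite -{1}(subnK (ltnW ij)) expgnDr conjgM => /conjg_inj e.
  by apply: commute_sym; rewrite /commute conjgC -e.
have /dvdnP[k ->] : (n %| (size s)`!)%N by rewrite dvdn_fact// n0.
by apply: commute_sym; rewrite mulnC expgnA; exact/commuteX/commute_sym.
Qed.

Lemma conj_class_id (H : groupType) (x : H) : conj_class x x.
Proof. by exists 1; rewrite ?conjg1. Qed.

Lemma FCE (H : groupType) : FC H = [set x | finite_set (conj_class x)].
Proof.
apply/seteqP; split=> [x [y /= fy [g _ <-]]|x /= fx]; last first.
  by exists x => //; exact: conj_class_id.
apply: sub_finite_set fy => _ [h _ <-].
by exists (g * h); rewrite ?conjgM.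
Qed.

(** Every conjugate of [x / y] is the quotient of a conjugate of [x] by one of [y], which leaves
    finitely many values. *)
Lemma FC_subgroup (H : groupType) : subgroup (FC H).
Proof.
rewrite FCE; apply/subgroupP; split=> [|x y fx fy] /=.
  by apply: sub_finite_set (finite_set1 1) => _ [g _ <-]; rewrite conj1g.
apply: sub_finite_set (finite_image2 (fun a b => a / b) fx fy).
move=> _ [g _ <-]; exists (x ^ g); first by exists g.
by exists (y ^ g); [exists g | rewrite conjMg conjVg].
Qed.

Lemma FC_conj (H : groupType) (x g : H) : FC H x -> FC H (x ^ g).
Proof.
move=> [y fy [h _ <-]]; exists y => //.
by exists (h * g); rewrite ?conjgM.
Qed.

Lemma iccP (H : groupType) :
  nontrivial H -> icc H <-> (forall x, FC H x -> x = 1).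
Proof.
rewrite FCE => ntH; split=> [[_ cc] x fx|fc1].
  by apply/eqP/negPn/negP => /cc /(_ fx).
by split=> // x /eqP x1 fx; exact/x1/fc1.
Qed.

(** * Orbits in the kernel K and obstructions to being icc *)

Section Extension.
Variables (K G Q : groupType) (E : extension K G Q).
Local Notation iota := (ext_inj E).
Local Notation rho := (ext_proj E).

Lemma ext_iota_inj : injective iota.
Proof. exact: ext_inj_injective. Qed.

Lemma ext_rho_iota k : rho (iota k) = 1.
Proof.
have : range iota (iota k) by exists k.
by rewrite (ext_exact E).
Qed.

Lemma ext_rho_ker g : rho g = 1 -> exists k, iota k = g.
Proof.
move=> g1; suff [k _ <-] : range iota g by exists k.
by rewrite (ext_exact E).
Qed.

Lemma ext_pi_iota x k : ext_pi E (iota x) k = k ^ x.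
Proof. by apply: ext_iota_inj; rewrite ext_piE gmulfJ. Qed.

Lemma ext_piM g h k : ext_pi E (g * h) k = ext_pi E h (ext_pi E g k).
Proof. by rewrite gmulfM. Qed.

Lemma finite_ext_orbit k : finite_set (ext_orbit E k) <-> FC G (iota k).
Proof.
have cE : conj_class (iota k) = iota @` ext_orbit E k.
  apply/seteqP; split=> [_ [g _ <-]|_ [_ [g _ <-] <-]].
    by exists (ext_pi E g k); [exists g | rewrite ext_piE].
  by exists g => //; rewrite ext_piE.
rewrite FCE /= cE; split; first exact: finite_image.
move/(finite_preimage (in2W (@ext_iota_inj))); apply: sub_finite_set => x xo.
by exists x.
Qed.

(** The clauses are those of condition (i), in the same order, so that results on obstructions apply
    to the theorem by unfolding. *)
Definition obstruction (N : set K) := [/\ normal_subgroup N, N <> [set 1],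
  finite_set N \/ (exists n : nat, isomorphic_Zn n N),
  forall (g : G) (k : K), N k -> N (ext_pi E g k)
  & forall k : K, N k -> finite_set (ext_orbit E k)].

Lemma ext_orbit_id k : ext_orbit E k k.
Proof. by exists 1 => //; rewrite gmulf1. Qed.

Lemma ext_orbit_pi g k x : ext_orbit E k x -> ext_orbit E k (ext_pi E g x).
Proof. by move=> [h _ <-]; exists (h * g) => //; rewrite ext_piM. Qed.

Lemma ext_orbit_conj k x y : ext_orbit E k x -> ext_orbit E k (x ^ y).
Proof. by rewrite -ext_pi_iota; exact: ext_orbit_pi. Qed.

Lemma ext_piX g k n : ext_pi E g (k ^+ n) = ext_pi E g k ^+ n.
Proof.
by elim: n => [|n IH]; [exact: aut1 | rewrite !expgS autM IH].
Qed.

Lemma ext_orbitX k n x :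
  ext_orbit E (k ^+ n) x -> exists2 y, ext_orbit E k y & x = y ^+ n.
Proof.
by move=> [g _ <-]; exists (ext_pi E g k); [exists g | rewrite ext_piX].
Qed.

Lemma smallest_orbit_FC k : FC G (iota k) ->
  smallest subgroup (ext_orbit E k) `<=` iota @^-1` FC G.
Proof.
move=> fk; have gF := FC_subgroup G.
apply: smallest_sub => [|_ [g _ <-]].
  apply/subgroupP; split=> [|x y fx fy]; rewrite /preimage /=.
    by rewrite gmulf1; exact: subgroup1.
  by rewrite gmulfF; exact: subgroupF.
by rewrite /preimage /= ext_piE; exact: FC_conj.
Qed.

(** For the subgroup generated by an orbit, only the alternative between finite and Z^n remains to
    be shown. Normality in [K] follows from invariance, since [iota x] acts as conjugation by
    [x]. *)
Lemma obstruction_orbit k : k <> 1 -> FC G (iota k) ->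
  let N := smallest subgroup (ext_orbit E k) in
  finite_set N \/ (exists n, isomorphic_Zn n N) -> obstruction N.
Proof.
move=> k1 fk N Nfin.
have gN : subgroup N := smallest_subgroup _.
have Npi g x : N x -> N (ext_pi E g x).
  apply: smallest_subgroup_morph => [|y z|y]; first exact: aut1.
    by rewrite autM autV.
  exact: ext_orbit_pi.
split=> //.
- by split=> // x g; rewrite -ext_pi_iota; exact: Npi.
- move=> N1; apply: k1; suff : N k by rewrite N1.
  by apply: sub_gen_smallest; exact: ext_orbit_id.
by move=> x /(smallest_orbit_FC fk)/finite_ext_orbit.
Qed.

Lemma torsion_obstruction k : k <> 1 -> FC G (iota k) -> torsion k ->
  exists N, obstruction N.
Proof.
move=> k1 fk [m m0 km]; eexists; apply: (obstruction_orbit k1 fk); left.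
have /finite_seqP[s sE] := (finite_ext_orbit k).2 fk.
have inS x : (x \in s) = `[< ext_orbit E k x >] by rewrite sE asboolb.
rewrite sE; apply: (@finite_smallest_subgroup _ _ m) => //.
  by move=> x y; rewrite !inS => /asboolP xo _; apply/asboolP/ext_orbit_conj.
by move=> x; rewrite inS => /asboolP[g _ <-]; rewrite -ext_piX km aut1.
Qed.

Lemma torsion_free_obstruction k : k <> 1 -> FC G (iota k) ->
  (forall x, FC G (iota x) -> torsion x -> x = 1) -> exists N, obstruction N.
Proof.
move=> k1 fk tf.
have [|m m0 mC] := common_commuting_power ((finite_ext_orbit k).2 fk).
  by move=> x y xo _; exact: ext_orbit_conj.
(* Absence of torsion ensures that passing to the [m]-th power does not lose non-triviality. *)
have km1 : k ^+ m <> 1 by move=> km; apply: k1; apply: tf => //; exists m.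
have fkm : FC G (iota (k ^+ m)).
  by rewrite gmulfXn; apply: subgroupX fk; exact: FC_subgroup.
have ob := obstruction_orbit km1 fkm.
exists (smallest subgroup (ext_orbit E (k ^+ m))); apply: ob; right.
have /finite_seqP[s sE] := (finite_ext_orbit _).2 fkm.
have [|n [f fD fE]] := @commuting_zmorph _ s.
  move=> x y xs ys.
  have [x' x'o ->] : exists2 x', ext_orbit E k x' & x = x' ^+ m.
    by apply: ext_orbitX; rewrite sE.
  have [y' y'o ->] : exists2 y', ext_orbit E k y' & y = y' ^+ m.
    by apply: ext_orbitX; rewrite sE.
  by apply: commuteX; exact: mC.
rewrite sE -fE; apply: torsion_free_isomorphic_Zn => // x.
by rewrite fE -sE => /(smallest_orbit_FC fkm); exact: tf.
Qed.

(** The obstruction need not contain [k]: any non-trivial torsion element of [K] lying in [FC G]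
    gives a finite one, and only in the absence of such elements is [k] itself used. *)
Lemma FC_obstruction k : k <> 1 -> FC G (iota k) -> exists N, obstruction N.
Proof.
move=> k1 fk.
have [[x [fx tx x1]]|no_torsion] :=
  pselect (exists x, [/\ FC G (iota x), torsion x & x <> 1]).
  exact: torsion_obstruction x1 fx tx.
apply: torsion_free_obstruction k1 fk _ => x fx tx.
by apply: contrapT => x1; apply: no_torsion; exists x.
Qed.

(** * FC of G against FC of Q, and injectivity of theta *)

Lemma FC_rho g : FC G g -> FC Q (rho g).
Proof.
rewrite !FCE /= => fg; apply: sub_finite_set (finite_image rho fg).
move=> _ [q _ <-]; have [h <-] := ext_proj_surjective E q.
by exists (g ^ h); [exists h | rewrite gmulfJ].
Qed.

(* If [FC G] avoids [K] then it centralizes [K], both being normal. *)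
Lemma FC_trivial : ~ (exists N, obstruction N) ->
  set_inj (FC Q) (ext_theta E) -> forall g, FC G g -> g = 1.
Proof.
move=> noN th_inj g fg.
have FK1 k : FC G (iota k) -> k = 1.
  by move=> fk; apply: contrapT => k1; apply: noN; exact: FC_obstruction fk.
have pi1 : ext_pi E g = 1.
  apply: aut_eq => k; rewrite aut_oneE; apply/divg1_eq/FK1.
  (* The quotient of [iota k ^ g] by [iota k] lies in the image of [K]; regrouped, it is [g^-1]
     times a conjugate of [g], hence also in [FC G]. *)
  rewrite gmulfF ext_piE conjgE -mulgA.
  rewrite (_ : _ * _ = g^-1 * g ^ (iota k)^-1); last first.
    by rewrite conjgE invgK !mulgA.
  apply: subgroupM (FC_subgroup G) _ (FC_conj _ fg).
  exact: subgroupV (FC_subgroup G) fg.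
have rg1 : rho g = 1.
  apply: th_inj; rewrite ?inE; [exact: FC_rho | |].
    exact: subgroup1 (FC_subgroup Q).
  by rewrite ext_thetaE pi1 gmulf1.
have [k kE] := ext_rho_ker rg1.
by move: fg; rewrite -kE => /FK1->; rewrite gmulf1.
Qed.

(* An element [p] of the kernel lifts to [h] centralizing [K]; as [K] is
   centerless, [rho] embeds the conjugacy class of [h] in that of [p]. *)
Lemma theta_injective : center K = [set 1] -> (forall g, FC G g -> g = 1) ->
  set_inj (FC Q) (ext_theta E).
Proof.
move=> ZK1 FC1.
suff ker1 p : FC Q p -> ext_theta E p = 1 -> p = 1.
  move=> q r; rewrite !inE => fq fr thqr; apply/divg1_eq/ker1.
    exact: subgroupF (FC_subgroup Q) fq fr.
  by rewrite gmulfF /= thqr mulgV.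
rewrite FCE => fp thp.
have [g gp] := ext_proj_surjective E p.
have [k _ kE] : Inn (ext_pi E g).
  rewrite -[ext_pi E g]mul1g -{1}(invg1 (Aut K)).
  by apply/outP; rewrite -ext_thetaE gp thp.
(* [g] acts on [K] as conjugation by [k], so dividing by [iota k] gives a lift of [p] that acts
   trivially. *)
pose h := g / iota k.
have rh : rho h = p by rewrite gmulfF ext_rho_iota divg1.
pose Z := [set x : G | forall y, commute x (iota y)].
have ZJ x y : Z x -> Z (x ^ y).
  (* [x] commutes with the conjugate of [iota z] by [y^-1], which is in the image of [K];
     conjugating back by [y] gives the claim. *)
  move=> Zx z; have := Zx (ext_pi E y^-1 z).
  move/(congr1 (fun t => t ^ y)); rewrite !conjMg ext_piE conjgKV.
  by [].
have Zh : Z h.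
  move=> y; apply/esym; rewrite /commute conjgC; congr (_ * _).
  rewrite -ext_piE /h ext_piM -kE innerE -gmulfV ext_pi_iota.
  by rewrite conjgK.
have Z1 x : Z x -> rho x = 1 -> x = 1.
  move=> Zx /ext_rho_ker[z zx]; suff z1 : z = 1 by rewrite -zx z1 gmulf1.
  have : center K z; last by rewrite ZK1.
  by move=> y; rewrite /commute; apply: ext_iota_inj; rewrite !gmulfM zx Zx.
have gZ : subgroup Z.
  apply/subgroupP; split=> [y|x y Zx Zy z]; first exact/commute_sym/commute1.
  apply: commute_sym; apply: commuteM; first exact/commute_sym.
  exact/commuteV/commute_sym.
rewrite -rh (FC1 h) ?gmulf1// FCE /=.
have ZC : conj_class h `<=` Z by move=> _ [x _ <-]; exact: ZJ.
(* Two conjugates of [h] with the same image under [rho] differ by an element of [Z] in the kernel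
   of [rho], which is 1 by [Z1]. *)
suff rho_inj : {in conj_class h &, injective rho}.
  rewrite -(eq_finite_set (inj_card_eq rho_inj)); apply: sub_finite_set fp.
  by move=> _ [_ [x _ <-] <-]; exists (rho x); rewrite // gmulfJ rh.
move=> x y; rewrite !inE => /ZC Zx /ZC Zy rxy; apply/divg1_eq/Z1.
  exact: subgroupF gZ Zx Zy.
by rewrite gmulfF rxy mulgV.
Qed.

End Extension.

Theorem theorem2 (K G Q : groupType) (E : extension K G Q)
    (G_neq1 : nontrivial G) (K_centerless : center K = [set 1%g]%classic) :
  icc G <->
  ~ (exists N : set K,
       [/\ normal_subgroup N,
           N <> [set 1%g]%classic,
           finite_set N \/ (exists n : nat, isomorphic_Zn n N),
           forall (g : G) (k : K), N k -> N (ext_pi E g k)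
         & forall k : K, N k -> finite_set (ext_orbit E k)])
  /\ set_inj (FC Q) (ext_theta E).
Proof.
rewrite iccP//; split=> [FC1|[noN th_inj]]; last exact: FC_trivial noN th_inj.
split; last exact: theta_injective.
move=> [N [[gN _] N1 _ _ Nfin]]; apply: N1; apply/seteqP; split=> x; last first.
  by move=> ->; exact: subgroup1 gN.
move=> /Nfin/finite_ext_orbit/FC1/eqP.
by rewrite gmulf_eq1; [move/eqP | exact: ext_iota_inj].
Qed.
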